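(* Let $q$ be a prime power and let $r\geq 2$ be an integer. Let $\mathbb{F}=\mathrm{GF}(q^{r-1})$ and let $H\subseteq\mathbb{F}^\ast$ be the subgroup of the multiplicative group of order $q^{r-2}+\cdots+q+1$. Let $G(q^{r-1},q^{r-2}+\cdots+q+1)$ be the graph whose vertex set is $(\mathbb{F}\times\mathbb{F}\setminus\{(0,0)\})/\sim$, where $(a_1,b_1)\sim(a_2,b_2)$ iff there is $h\in H$ with $a_1=ha_2$ and $b_1=hb_2$, and in which two distinct vertices $\langle a,b\rangle$ and $\langle x,y\rangle$ are adjacent iff $ax+by\in H$. Then this graph is $K_{r,(r-1)!+1}$-free.
   Context: $\langle a,b\rangle$ denotes the equivalence class of $(a,b)$; adjacency is independent of representatives; the graph is simple (no loops). A graph is $K_{s,u}$-free if it contains no (not necessarily induced) subgraph isomorphic to the complete bipartite graph $K_{s,u}$. *)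

(* Defs.v *)
From HB Require Import structures.
From mathcomp Require Import all_boot all_order all_algebra all_fingroup.
Set Implicit Arguments. Unset Strict Implicit. Unset Printing Implicit Defensive.
Import GRing.Theory.
Local Open Scope ring_scope.

Definition inH (F : finFieldType) (H : {set {unit F}}) (x : F) : bool :=
  [exists u in H, val u == x].

Definition simH (F : finFieldType) (H : {set {unit F}}) (v w : F * F) : bool :=
  [exists u in H, (v.1 == val u * w.1) && (v.2 == val u * w.2)].

Definition cls (F : finFieldType) (H : {set {unit F}}) (v : F * F) : {set F * F} :=
  [set w | simH H w v].

Definition vset (F : finFieldType) (H : {set {unit F}}) : {set {set F * F}} :=
  cls H @: [set v : F * F | v != (0, 0)].

Definition adjG (F : finFieldType) (H : {set {unit F}}) (C D : {set F * F}) : bool :=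
  (C != D) && [exists v in C, exists w in D, inH H (v.1 * w.1 + v.2 * w.2)].

Definition Kfree (T : finType) (V : {set T}) (adj : rel T) (s u : nat) : Prop :=
  ~ exists A B : {set T},
      [/\ A \subset V, B \subset V, [disjoint A & B], #|A| = s & #|B| = u] /\
      (forall x y, x \in A -> y \in B -> adj x y).

(* Main.v *)
Require Import Defs.
From HB Require Import structures.
From mathcomp Require Import all_boot all_order all_algebra all_fingroup all_field.
From mathcomp Require Import cyclic ring zify.
Set Implicit Arguments. Unset Strict Implicit. Unset Printing Implicit Defensive.
Import GRing.Theory.
Local Open Scope ring_scope.

(** The group [H] is the kernel of the norm [N y = y ^+ #|H|] onto GF(q), so with t = r - 1 a common
neighbour <x,y> of r vertices <a_i,b_i> solves N(a_i x + b_i y) = 1 for all i. Distinct vertices with a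
common neighbour are not proportional; rescaling <x,y> so that a_0 x + b_0 y = 1 leaves one unknown z and
t equations N(z - c_i) = d_i with distinct c_i. Since N(z - c) is the product of the z^(q^j) - c^(q^j), this
is an instance of a system [prod_(j < t) (x_j - a_ij) = b_i] (i < t) with [a_ij <> a_i'j] for [i <> i'], and
such a system has at most t! solutions over any field (Kollar, Ronyai, Szabo).

That bound is obtained by linear algebra: the functions on the solution set are spanned by the t!
monomials [prod_j x_j ^ e_j] with [e_j <= j]. To lower degrees, the factor in the last variable is
interpolated at the nodes [a_in]: each Lagrange polynomial, and the nodal polynomial, contains the factors
needed to complete a product over the first n variables to a left-hand side of the system, which is then
replaced by the constant [b_i]. Spanning is tested dually, on weights that annihilate all the products. *)

(** * Univariate interpolation *)

Lemma size_poly_coef_sum (R : nzRingType) (p : {poly R}) n :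
  (size p <= n)%N -> p = \sum_(0 <= e < n) p`_e *: 'X^e.
Proof.
move=> sp; apply/polyP => i; rewrite big_mkord coef_sum.
under eq_bigr => e _ do rewrite coefZ coefXn.
case: (ltnP i n) => [ltin|leni].
  rewrite (bigD1 (Ordinal ltin)) //= eqxx mulr1 big1 ?addr0 // => e ne.
  by rewrite [_ == _](negbTE _) ?mulr0 // eq_sym.
rewrite nth_default ?(leq_trans sp) // big1 // => e _.
by rewrite gtn_eqF ?mulr0 // (leq_trans (ltn_ord e)).
Qed.

(** Euclidean division by the nodal polynomial: [k] is the quotient, and the remainder is recovered
    from its values at the nodes. *)
Lemma lagrange_decomposition (K : fieldType) (I : eqType) (s : seq I)
    (a : I -> K) (p : {poly K}) :
  uniq s -> {in s &, injective a} ->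
  exists c : I -> K, exists2 k : {poly K}, (size k <= size p - size s)%N &
    p = \sum_(i <- s) c i *: (\prod_(i' <- s | i' != i) ('X - (a i')%:P))
        + (\prod_(i <- s) ('X - (a i)%:P)) * k.
Proof.
move=> us ia.
set M := \prod_(i <- s) _.
pose L i := \prod_(i' <- s | i' != i) ('X - (a i')%:P).
have ML i : i \in s -> M = ('X - (a i)%:P) * L i.
  by move=> si; rewrite /M (bigD1_seq i).
have sM : size M = (size s).+1 by rewrite size_prod_XsubC.
have M0 : M != 0 by rewrite -size_poly_eq0 sM.
have Lii i : i \in s -> (L i).[a i] != 0.
  move=> si; rewrite horner_prod prodf_seq_neq0; apply/allP => j sj.
  by apply/implyP => ji; rewrite hornerXsubC subr_eq0 (inj_in_eq ia) // eq_sym.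
have Lij i j : i \in s -> j != i -> (L j).[a i] = 0.
  move=> si ji; apply/eqP; rewrite horner_prod prodf_seq_eq0.
  by apply/hasP; exists i; rewrite // hornerXsubC subrr eqxx eq_sym ji.
have sL i : i \in s -> (size (L i) <= size s)%N.
  move=> si; rewrite -ltnS -sM (ML i si) size_mul ?polyXsubC_eq0 ?size_XsubC //.
  by apply/eqP => Li0; move: (Lii i si); rewrite Li0 horner0 eqxx.
exists (fun i => p.[a i] / (L i).[a i]), (p %/ M).
  by rewrite size_divp // sM.
set r := \sum_(i <- s) _.
suff -> : r = p %% M by rewrite addrC mulrC -divp_eq.
apply/eqP; rewrite -subr_eq0; apply/eqP/(@roots_geq_poly_eq0 _ _ (map a s)).
- apply/allP => _ /mapP[i si ->]; rewrite rootE hornerD hornerN subr_eq0.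
  rewrite horner_sum (bigD1_seq i) //= [X in _ + X]big1 => [|j ji]; last first.
    by rewrite hornerZ -/(L j) (Lij i j) // mulr0.
  rewrite hornerZ -/(L i) divfK ?Lii // addr0 {1}(divp_eq p M) hornerD hornerM.
  by rewrite (ML i si) hornerM hornerXsubC subrr mul0r mulr0 add0r.
- by rewrite map_inj_in_uniq.
- rewrite size_map; apply: leq_trans (size_polyD _ _) _.
  rewrite size_polyN geq_max -ltnS -[X in _ && X]ltnS -sM ltn_modp M0 andbT sM ltnS.
  apply: leq_trans (size_sum _ _ _) _.
  rewrite big_seq; elim/big_ind: _ => [//|m n|i si]; first by rewrite geq_max => -> ->.
  exact: leq_trans (size_scale_leq _ _) (sL _ si).
Qed.

Lemma count_neq (I : eqType) (s : seq I) (i : I) :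
  uniq s -> i \in s -> (count (fun l => l != i) s).+1 = size s.
Proof.
move=> us si; rewrite -(count_predC (pred1 i) s) count_uniq_mem // si add1n.
by congr _.+1; apply: eq_count.
Qed.

(** * Product systems: degree reduction and the factorial bound *)

Section ProductSystem.
Variables (K : fieldType) (T : finType) (x : T -> nat -> K).
Variables (I : eqType) (a : I -> nat -> K).

(** The slack [m] measures degree: [m = 1] is the span of the staircase monomials, and growing [m]
    reaches all products of univariate polynomials. *)
Definition annihilates n m (lam : T -> K) :=
  forall p : nat -> {poly K}, (forall j, j < n -> size (p j) <= j + m)%N ->
    \sum_z lam z * \prod_(j < n) (p j).[x z j] = 0.

Definition prod_system n i z := \prod_(j < n) (x z j - a i j).

Lemma annihilates_ext n m lam lam' :
  lam =1 lam' -> annihilates n m lam -> annihilates n m lam'.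
Proof.
by move=> e h p sp; rewrite -[RHS](h p sp); apply: eq_bigr => z _; rewrite e.
Qed.

Lemma annihilates_last n m lam (P : {poly K}) :
  annihilates n.+1 m lam -> (size P <= n + m)%N ->
  annihilates n m (fun z => lam z * P.[x z n]).
Proof.
move=> h sP p sp.
rewrite -[RHS](h (fun j => if j == n then P else p j)); last first.
  by move=> j; case: eqP => [-> //|/eqP jn]; rewrite ltnS leq_eqVlt (negbTE jn) => /sp.
apply: eq_bigr => z _; rewrite big_ord_recr /= eqxx -mulrA [P.[_] * _]mulrC.
by congr (_ * (_ * _)); apply: eq_bigr => j _; rewrite ltn_eqF.
Qed.

Lemma size_prod_XsubC_filter n (s : seq I) (P : pred I) :
  size (\prod_(i <- s | P i) ('X - (a i n)%:P)) = (count P s).+1.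
Proof. by rewrite -big_filter size_prod_XsubC size_filter. Qed.

Lemma annihilates_interpolation n m s lam :
  uniq s -> {in s &, injective (a^~ n)} ->
  (forall i, i \in s -> annihilates n m
     (fun z => lam z * (\prod_(i' <- s | i' != i) ('X - (a i' n)%:P)).[x z n])) ->
  (forall k : {poly K}, (size k <= n + m - size s)%N -> annihilates n m
     (fun z => lam z * (\prod_(i <- s) ('X - (a i n)%:P) * k).[x z n])) ->
  annihilates n.+1 m lam.
Proof.
move=> us ia hL hM p sp.
have [c [k sk ep]] := lagrange_decomposition (p n) us ia.
have sp' j : (j < n -> size (p j) <= j + m)%N by move=> jn; apply/sp/leqW.
under eq_bigr => z _.
  rewrite big_ord_recr /= ep hornerD horner_sum mulrDr mulrDr.
  over.
rewrite big_split /= [X in _ + X](_ : _ = 0) ?addr0; last first.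
  rewrite -[RHS](hM k (leq_trans sk (leq_sub2r _ (sp n (leqnn _)))) p sp').
  by apply: eq_bigr => z _; rewrite -mulrA [_.[_] * _]mulrC.
under eq_bigr do rewrite mulr_sumr mulr_sumr.
rewrite exchange_big big_seq big1 //= => i si.
rewrite -[RHS](mulr0 (c i)) -[in RHS](hL i si p sp') mulr_sumr.
apply: eq_bigr => z _; rewrite hornerZ.
by ring.
Qed.

Lemma prod_systemS n i z : prod_system n.+1 i z = prod_system n i z * (x z n - a i n).
Proof. by rewrite /prod_system big_ord_recr. Qed.

Definition separated n (s : seq I) :=
  forall j, (j < n)%N -> {in s &, injective (a^~ j)}.

Lemma separated_sub n n' s s' :
  (n' <= n)%N -> {subset s' <= s} -> separated n s -> separated n' s'.
Proof.
move=> le_n ss h j jn i i' si si'.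
by apply: (h j (leq_trans jn le_n)); apply: ss.
Qed.

(** The factor of [Q] at the node of row [i] completes [prod_system n i]; only the cofactor [P] has
    to fit the degree bound. *)
Lemma annihilates_row n m lam i (Q P : {poly K}) :
  annihilates n.+1 m (fun z => lam z * prod_system n.+1 i z) ->
  (size P <= n + m)%N -> Q = ('X - (a i n)%:P) * P ->
  annihilates n m (fun z => lam z * Q.[x z n] * prod_system n i z).
Proof.
move=> h sP ->; apply: annihilates_ext (annihilates_last h sP) => z.
rewrite prod_systemS hornerM hornerXsubC; ring.
Qed.

(* [lam'] abstracts the two kinds of modified weights, so that the lemma serves as the common
   inductive step for [n.+1] rows and for [n.+2] rows in [n.+1] variables. *)
Lemma annihilates_interpolation_rows n k s lam :
  uniq s -> (size s <= n.+2)%N -> separated n.+1 s ->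
  (forall i, i \in s ->
     annihilates n.+1 k.+1 (fun z => lam z * prod_system n.+1 i z)) ->
  (forall i lam', i \in s ->
     (forall i', i' \in [seq i' <- s | i' != i] ->
        annihilates n k.+1 (fun z => lam' z * prod_system n i' z)) ->
     lam' =1 (fun z => lam z * (\prod_(i' <- s | i' != i) ('X - (a i' n)%:P)).[x z n]) ->
     annihilates n k.+2 lam') ->
  (forall lam',
     (forall i', i' \in s ->
        annihilates n k.+1 (fun z => lam' z * prod_system n i' z)) ->
     annihilates n k.+2 lam') ->
  annihilates n.+1 k.+2 lam.
Proof.
move=> us ss sep hf hL hM.
apply: (annihilates_interpolation us (sep n (leqnn _))) => [i si|Q sQ].
  apply: (hL i _ si) => // i'; rewrite mem_filter => /andP[ni' si'].
  pose P := \prod_(l <- s | (l != i) && (l != i')) ('X - (a l n)%:P).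
  apply: (@annihilates_row n k.+1 lam i' _ P (hf _ si')); last first.
    rewrite -big_filter (bigD1_seq i') ?mem_filter ?ni' ?filter_uniq //=.
    by rewrite big_filter_cond.
  rewrite /P -big_filter_cond size_prod_XsubC_filter.
  have := count_neq (filter_uniq (fun l => l != i) us) (i := i').
  rewrite mem_filter ni' si' => /(_ isT); rewrite size_filter.
  by have := count_neq us si; lia.
apply: hM => i' si'.
(* Removing the factor at [i'] lowers the size by one, which matches the drop in slack from [k.+2]
   to [k.+1]. *)
pose P := \prod_(l <- s | l != i') ('X - (a l n)%:P) * Q.
apply: (@annihilates_row n k.+1 lam i' _ P (hf _ si')); last first.
  by rewrite (bigD1_seq i') //= mulrA.
apply: leq_trans (size_polyMleq _ _) _.
rewrite size_prod_XsubC_filter.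
by have := count_neq us si'; lia.
Qed.

(** Each variable can make the product vanish on at most one row, so [n.+1] rows in [n] variables
    have no common zero. This is the matching unit-ideal statement, with control of degrees. *)
Lemma annihilates_overdetermined n k s lam :
  uniq s -> size s = n.+1 -> separated n s ->
  (forall i, i \in s -> annihilates n k.+1 (fun z => lam z * prod_system n i z)) ->
  annihilates n k.+2 lam.
Proof.
elim: n s lam => [|n IH] s lam us ss sep hf.
  case: s ss us sep hf => // i s _ _ _ /(_ i (mem_head _ _)) h p _.
  rewrite -[RHS](h p) //; apply: eq_bigr => z _.
  by rewrite /prod_system !big_ord0 !mulr1.
apply: (annihilates_interpolation_rows us _ sep hf) => [|i lam' si h _|lam' h].
- by rewrite ss.
- apply: (IH _ _ (filter_uniq _ us) _ _ h).
    by rewrite size_filter; have := count_neq us si; lia.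
  by apply: separated_sub sep => // l; rewrite mem_filter => /andP[].
(* The nodal part keeps all [n.+2] rows with only [n] variables, one row too many for the induction;
   the first is dropped. *)
- have bs : {subset behead s <= s} by move=> l; apply: mem_behead.
  apply: (IH (behead s)) => [|||i /bs /h //].
  + by case: (s) us => //= i s' /andP[].
  + by rewrite size_behead ss.
  + exact: separated_sub sep.
Qed.

(** A Lagrange part loses one row and one variable, so it stays square and inherits the hypothesis
    at slack 1; the nodal part keeps all rows and becomes overdetermined. *)
Lemma annihilates_square n k s lam :
  uniq s -> size s = n -> separated n s ->
  (forall i, i \in s -> annihilates n k.+1 (fun z => lam z * prod_system n i z)) ->
  annihilates n 1 lam -> annihilates n k.+2 lam.
Proof.
elim: n s lam => [|n IH] s lam us ss sep hf h1.
  by move=> p _; apply: h1.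
have sep' : separated n s by apply: separated_sub sep.
apply: (annihilates_interpolation_rows us _ sep hf) => [|i lam' si h e|lam' h].
- by rewrite ss.
- apply: (IH _ _ (filter_uniq _ us) _ _ h).
  + by rewrite size_filter; have := count_neq us si; lia.
  + by apply: separated_sub sep => // l; rewrite mem_filter => /andP[].
  + apply: annihilates_ext (fsym e) _; apply: annihilates_last h1 _.
    by rewrite size_prod_XsubC_filter; have := count_neq us si; lia.
- exact: annihilates_overdetermined us ss sep' h.
Qed.

(** On solutions a left-hand side is the constant [b i], so slack [k.+1] yields the row hypotheses
    needed to reach [k.+2]. *)
Lemma annihilates_solutions n s (b : I -> K) lam :
  uniq s -> size s = n -> separated n s ->
  (forall i z, i \in s -> prod_system n i z = b i) ->
  annihilates n 1 lam -> forall m, annihilates n m.+1 lam.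
Proof.
move=> us ss sep hb h1; elim=> // k IH.
apply: (annihilates_square us ss sep) => // i si p sp.
rewrite -[RHS](mulr0 (b i)) -[in RHS](IH p sp) mulr_sumr.
by apply: eq_bigr => z _; rewrite hb // mulrAC mulrC mulrA.
Qed.

(** With unbounded degree the products include a nonzero multiple of the indicator of each point,
    which isolates one weight. *)
Lemma annihilates_eq0 n lam :
  (forall z z', (forall j, (j < n)%N -> x z j = x z' j) -> z = z') ->
  (forall m, annihilates n m.+1 lam) -> lam =1 fun=> 0.
Proof.
move=> inj_x h z0.
pose p j := \prod_(z | x z j != x z0 j) ('X - (x z j)%:P).
pose m := (\max_(j < n) size (p j))%N.
have sp j : (j < n)%N -> (size (p j) <= j + m.+1)%N.
  move=> jn; have := @leq_bigmax _ (fun j : 'I_n => size (p j)) (Ordinal jn).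
  rewrite /= -/m; lia.
have := h m p sp; rewrite (bigD1 z0) //= [X in _ + X]big1 ?addr0.
  move/eqP; rewrite mulf_eq0 => /orP[/eqP //|].
  rewrite prodf_seq_eq0 => /hasP[j _] /=.
  rewrite horner_prod prodf_seq_eq0 => /hasP[z _ /andP[nz]].
  by rewrite hornerXsubC subr_eq0 eq_sym (negbTE nz).
move=> z nz; apply/eqP; rewrite mulf_eq0 prodf_seq_eq0; apply/orP; right.
have [/existsP[j nj]|/existsPn e] := boolP [exists j : 'I_n, x z j != x z0 j].
  apply/hasP; exists j; rewrite ?mem_index_enum //= horner_prod prodf_seq_eq0.
  by apply/hasP; exists z; rewrite ?mem_index_enum // nj hornerXsubC subrr eqxx.
case/eqP: nz; apply: inj_x => j jn.
by apply/eqP; rewrite -[_ == _]negbK (e (Ordinal jn)).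
Qed.

Lemma staircase_spanning n :
  exists2 B : seq {ffun T -> K}, size B = n`! &
    forall lam, (forall b, b \in B -> \sum_z lam z * b z = 0) -> annihilates n 1 lam.
Proof.
elim: n => [|n [B sB hB]].
  exists [:: [ffun=> 1]] => // lam h p _.
  rewrite -[RHS](h [ffun=> 1] (mem_head _ _)).
  by apply: eq_bigr => z _; rewrite big_ord0 ffunE.
(* Variable [n] takes the exponents 0 to [n], hence the factor [n.+1] of the factorial. *)
exists [seq [ffun z => b z * x z n ^+ e] | b : {ffun T -> K} <- B, e : nat <- iota 0 n.+1].
  by rewrite size_allpairs size_iota sB factS mulnC.
move=> lam h p sp.
under eq_bigr => z _.
  rewrite big_ord_recr /= (size_poly_coef_sum (sp n (leqnn _))) horner_sum.
  rewrite !mulr_sumr; over.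
rewrite exchange_big big_seq big1 //= => e; rewrite addn1 mem_index_iota => /= en.
have := hB (fun z => lam z * x z n ^+ e) _ p (fun j jn => sp j (ltnW jn)).
move=> he; rewrite -[RHS](mulr0 (p n)`_e); move: (p n)`_e => c.
rewrite -[in RHS]he ?mulr_sumr.
  by apply: eq_bigr => z _; rewrite hornerZ hornerXn; ring.
move=> b Bb; rewrite -[RHS](h [ffun z => b z * x z n ^+ e]).
  by apply: eq_bigr => z _; rewrite ffunE; ring.
by apply/allpairsP; exists (b, e); rewrite mem_iota.
Qed.

Lemma exists_annihilating_weights (B : seq {ffun T -> K}) :
  (size B < #|T|)%N ->
  exists2 lam : T -> K, (exists z, lam z != 0) &
    forall b, b \in B -> \sum_z lam z * b z = 0.
Proof.
move=> ltB.
pose M := \matrix_(i < #|T|, j < size B) (tnth (in_tuple B) j) (enum_val i).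
have /rowV0Pn[v /sub_kermxP vM v0] : kermx M != 0.
  by rewrite kermx_eq0 -row_leq_rank -ltnNge (leq_ltn_trans (rank_leq_col _)).
exists (fun z => v 0 (enum_rank z)).
  by case/rV0Pn: v0 => i vi; exists (enum_val i); rewrite enum_valK.
move=> b /(tnthP (in_tuple B))[j ->].
rewrite (reindex (enum_val : 'I_#|T| -> T)) /=; last exact/onW_bij/enum_val_bij.
have /matrixP/(_ 0 j) := vM; rewrite !mxE => e; rewrite -[RHS]e.
by apply: eq_bigr => i _; rewrite mxE enum_valK.
Qed.

Theorem product_system_card n s (b : I -> K) :
  uniq s -> size s = n -> separated n s ->
  (forall z z', (forall j, (j < n)%N -> x z j = x z' j) -> z = z') ->
  (forall i z, i \in s -> prod_system n i z = b i) ->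
  (#|T| <= n`!)%N.
Proof.
move=> us ss sep inj_x hb; rewrite leqNgt; apply/negP => ltT.
have [B sB hB] := staircase_spanning n; rewrite -sB in ltT.
have [lam [z nz] /hB h1] := exists_annihilating_weights ltT.
case/eqP: nz; exact: (annihilates_eq0 inj_x (annihilates_solutions us ss sep hb h1)).
Qed.
End ProductSystem.

(** * Frobenius powers and the norm-one subgroup *)

Lemma exprBn_pchar (R : comNzRingType) (x y : R) n :
  [pchar R].-nat n -> (x - y) ^+ n = x ^+ n - y ^+ n.
Proof. by move=> hn; rewrite -[in RHS](subrK y x) [in RHS]exprDn_pchar // addrK. Qed.

Lemma expr_inj_pchar (F : fieldType) n : [pchar F].-nat n -> injective (fun y : F => y ^+ n).
Proof.
move=> hn y y' /= e; apply/eqP; rewrite -subr_eq0.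
suff : (y - y') ^+ n == 0 by rewrite expf_eq0 => /andP[].
by rewrite exprBn_pchar // e subrr.
Qed.

(** [H] already supplies [#|H|] roots of [X^#|H| - 1], and over a field there are no more. *)
Lemma inH_expr (F : finFieldType) (H : {group {unit F}}) (y : F) :
  inH H y = (y ^+ #|H| == 1).
Proof.
apply/exists_inP/eqP => [[u uH /eqP <-]|y1].
  by rewrite -FinRing.val_unitX expg_cardG.
apply/exists_inP; apply: contraT => /exists_inPn nH.
have : (size (y :: [seq val u | u <- enum H]) <= #|H|)%N.
  apply: max_unity_roots; first exact: cardG_gt0.
    rewrite /= unity_rootE y1 eqxx; apply/allP => z /mapP[u].
    rewrite mem_enum => uH ->; apply/unity_rootP.
    by rewrite -FinRing.val_unitX expg_cardG.
  rewrite /= map_inj_uniq ?enum_uniq ?andbT; last exact: val_inj.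
  by apply/mapP => -[u]; rewrite mem_enum => /nH /eqP + e; rewrite e.
by rewrite /= size_map -cardE ltnn.
Qed.

(** * Vertices of the graph and their common neighbours *)

Section NormGraph.
Variables (F : finFieldType) (H : {group {unit F}}).

Definition dot (v w : F * F) := v.1 * w.1 + v.2 * w.2.
Definition scale2 (c : F) (v : F * F) := (c * v.1, c * v.2).

Lemma dot_scale c c' v w : dot (scale2 c v) (scale2 c' w) = c * c' * dot v w.
Proof. by rewrite /dot /=; ring. Qed.

Lemma mem_clsP v w : reflect (exists2 c, inH H c & w = scale2 c v) (w \in cls H v).
Proof.
rewrite inE; apply: (iffP exists_inP) => [[u uH /andP[/eqP e1 /eqP e2]]|[c]].
  exists (val u); first by apply/exists_inP; exists u.
  by rewrite /scale2 -e1 -e2; case: (w).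
by case/exists_inP=> u uH /eqP <- ->; exists u; rewrite // !eqxx.
Qed.

Lemma cls_eq v w : w \in cls H v -> cls H w = cls H v.
Proof.
case/mem_clsP => c; rewrite inH_expr => /eqP c1 ->.
have c0 : c != 0.
  by apply/eqP => c0; move/eqP: c1; rewrite c0 expr0n gtn_eqF ?cardG_gt0 // eq_sym oner_eq0.
apply/setP => y; apply/mem_clsP/mem_clsP => -[d]; rewrite inH_expr => /eqP d1 ->.
  exists (d * c); first by rewrite inH_expr exprMn d1 c1 mulr1.
  by rewrite /scale2 /= !mulrA.
exists (d / c); first by rewrite inH_expr expr_div_n d1 c1 divr1.
by rewrite /scale2 /= !mulrA divfK.
Qed.

Lemma vset_eq C v : C \in vset H -> v \in C -> C = cls H v.
Proof. by case/imsetP=> w _ -> /cls_eq. Qed.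

Lemma mem_cls_refl v : v \in cls H v.
Proof.
apply/mem_clsP; exists 1; first by rewrite inH_expr expr1n.
by rewrite /scale2 !mul1r; case: (v).
Qed.

Lemma vset_neq0 C : C \in vset H -> exists v, v \in C.
Proof. by case/imsetP=> w _ ->; exists w; apply: mem_cls_refl. Qed.

Lemma adjG_dot C D v w : C \in vset H -> D \in vset H -> v \in C -> w \in D ->
  adjG H C D -> dot v w ^+ #|H| = 1.
Proof.
move=> vC vD Cv Dw /andP[_ /exists_inP[v' + /exists_inP[w' + ]]].
rewrite (vset_eq vC Cv) (vset_eq vD Dw).
move=> /mem_clsP[c + ->] /mem_clsP[c' + ->].
rewrite -/(dot _ _) dot_scale !inH_expr !exprMn => /eqP -> /eqP ->.
by rewrite !mul1r => /eqP.
Qed.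

(** Comparing [#|H|]-th powers puts [c] in [H]; so distinct vertices with a common neighbour are not
    proportional. *)
Lemma cls_proportional v v' w c : v' = scale2 c v ->
  dot v w ^+ #|H| = 1 -> dot v' w ^+ #|H| = 1 -> cls H v' = cls H v.
Proof.
move=> -> e e'; apply: cls_eq; apply/mem_clsP; exists c => //.
rewrite inH_expr -e' -[w in dot _ w](_ : scale2 1 w = w).
  by rewrite dot_scale mulr1 exprMn e mulr1.
by rewrite /scale2 !mul1r; case: (w).
Qed.

Lemma vset_normalized C v w : C \in vset H -> w \in C -> dot v w ^+ #|H| = 1 ->
  exists2 w', w' \in C & dot v w' = 1.
Proof.
move=> vC Cw e.
have d0 : dot v w != 0.
  by apply/eqP => d0; move/eqP: e; rewrite d0 expr0n gtn_eqF ?cardG_gt0 // eq_sym oner_eq0.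
exists (scale2 (dot v w)^-1 w).
  rewrite (vset_eq vC Cw); apply/mem_clsP; exists (dot v w)^-1 => //.
  by rewrite inH_expr exprVn e invr1.
by rewrite -(mulVf d0) /dot /=; ring.
Qed.
End NormGraph.

(** * From a complete bipartite subgraph to a product system *)

Lemma norm_graph_Kfree (q t : nat) (F : finFieldType) (H : {group {unit F}}) :
  (exists p k : nat, prime p /\ q = (p ^ k)%N) -> (0 < t)%N ->
  #|F| = (q ^ t)%N -> #|H| = (\sum_(i < t) q ^ i)%N ->
  Kfree (vset H) (@adjG F H) t.+1 (t`!).+1.
Proof.
move=> [p [k [pp qE]]] t0 cF cH [A [B [[sA sB _ cA cB] adjAB]]].
have pF : p \in [pchar F].
  by apply: (@card_finPcharP _ _ (k * t)); rewrite // cF qE expnM.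
have qF j : [pchar F].-nat (q ^ j)%N by rewrite pnatX qE pnatX pnatE // pF.
pose rep (C : {set F * F}) := odflt (0, 0) [pick v in C].
have repP C : C \in A -> rep C \in C.
  move=> /(subsetP sA) /vset_neq0[v Cv]; rewrite /rep.
  by case: pickP => //= /(_ v); rewrite Cv.
have [C0 AC0] : exists C, C \in A by apply/set0Pn; rewrite -card_gt0 cA; lia.
have [D0 BD0] : exists D, D \in B by apply/set0Pn; rewrite -card_gt0 cB; lia.
pose v0 := rep C0.
(* Neighbours are normalised against [v0]; the default [(0, 0)] is never reached for [D] in [B]. *)
pose nrep (D : {set F * F}) := odflt (0, 0) [pick w in D | dot v0 w == 1].
have normAB C v D w : C \in A -> v \in C -> D \in B -> w \in D -> dot v w ^+ #|H| = 1.
  move=> CA Cv BD Dw; apply: (@adjG_dot _ _ C D) => //; last exact: adjAB.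
    exact: (subsetP sA).
  exact: (subsetP sB).
have nrepP D : D \in B -> (nrep D \in D) /\ dot v0 (nrep D) = 1.
  move=> BD; have vD := subsetP sB _ BD; have [w Dw] := vset_neq0 vD.
  have [w' Dw' e] := vset_normalized vD Dw (normAB _ _ _ _ AC0 (repP _ AC0) BD Dw).
  rewrite /nrep; case: pickP => /= [y /andP[Dy /eqP]|/(_ w')] //.
  by rewrite Dw' e eqxx.
have [D0w0 w0v0] := nrepP _ BD0; set w0 := nrep D0 in D0w0 w0v0.
(* [v1] completes [v0] to a basis of determinant 1, and [v = al v * v1 + be v * v0]. *)
pose v1 : F * F := (- w0.2, w0.1).
pose al (v : F * F) := v0.1 * v.2 - v0.2 * v.1.
pose be (v : F * F) := dot v w0.
have decomp v : v = (al v * v1.1 + be v * v0.1, al v * v1.2 + be v * v0.2).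
  case: v => c d; congr (_, _).
    by rewrite -[LHS]mulr1 -w0v0 /al /be /dot /v1 /=; ring.
  by rewrite -[LHS]mulr1 -w0v0 /al /be /dot /v1 /=; ring.
have scale_decomp c v : scale2 c v =
    (c * (al v * v1.1 + be v * v0.1), c * (al v * v1.2 + be v * v0.2)).
  by rewrite {1}[v]decomp.
have dot_decomp v w : dot v0 w = 1 -> dot v w = al v * dot v1 w + be v.
  move=> e; rewrite -[be v in RHS]mulr1 -e {1}[v]decomp /dot /=; ring.
have clsE C : C \in A -> C = cls H (rep C).
  by move=> CA; apply: vset_eq (subsetP sA _ CA) (repP _ CA).
have cls_inj C C' c : C \in A -> C' \in A -> rep C' = scale2 c (rep C) -> C' = C.
  move=> CA CA' e; rewrite (clsE _ CA) (clsE _ CA').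
  by apply: (cls_proportional e (w := w0)); apply: normAB BD0 D0w0; try exact: repP.
(* If [al] vanished, the representative would be a multiple of [v0], and the vertex would be
   [C0]. *)
have al0 C : C \in A :\ C0 -> al (rep C) != 0.
  rewrite in_setD1 => /andP[nC CA]; apply: contraNneq nC => e; apply/eqP.
  apply: (cls_inj _ _ (be (rep C)) AC0 CA).
  by rewrite {1}[rep C]decomp e !mul0r !add0r.
(* [C0] is spent on the normalisation; the other [t] vertices give the rows. *)
pose s := enum (A :\ C0).
pose root_of (C : {set F * F}) := - (be (rep C) / al (rep C)).
pose a C j := root_of C ^+ (q ^ j).
pose T := {D | D \in B}.
pose x (D : T) j := dot v1 (nrep (val D)) ^+ (q ^ j).
suff : (#|{: T}| <= t`!)%N.
  by rewrite card_sig (eq_card (_ : _ =i B)) ?cB ?ltnn // => D; rewrite inE.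
have memT (D : T) : val D \in B by apply: valP.
(* With [z = dot v1 w], the equation N(al (z - root)) = 1 gives the right-hand side N(al)^-1. *)
apply: (@product_system_card F T x _ a t s (fun C => (al (rep C) ^+ #|H|)^-1)).
- exact: enum_uniq.
- by apply/eqP; rewrite -cardE -eqSS -cA (cardsD1 C0 A) AC0.
- move=> j _ C C'; rewrite !mem_enum => sC sC' /(expr_inj_pchar (qF j)) /oppr_inj e.
  have [CA CA'] : C \in A /\ C' \in A by move: sC sC'; rewrite !in_setD1 => /andP[_ ->] /andP[_ ->].
  apply/esym/(cls_inj _ _ (al (rep C') / al (rep C)) CA CA').
  have eb : be (rep C') = al (rep C') / al (rep C) * be (rep C).
    by rewrite mulrAC -mulrA e mulrC divfK ?al0.
  rewrite scale_decomp [LHS]decomp eb.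
  by congr (_, _); field; apply: al0.
(* The conjugate [j = 0] is [dot v1 w] itself; together with [dot v0 w = 1] it determines [w]. *)
- move=> D D' /(_ 0%N); rewrite /x expn0 !expr1 => e.
  have {}e : dot v1 (nrep (val D)) = dot v1 (nrep (val D')) by exact: e.
  have [[m1 d1] [m2 d2]] := (nrepP _ (memT D), nrepP _ (memT D')).
  apply: val_inj; rewrite (vset_eq (subsetP sB _ (memT D)) m1).
  rewrite (vset_eq (subsetP sB _ (memT D')) m2); congr (cls H _).
  have coord w : w = (w0.1 * dot v0 w - v0.2 * dot v1 w, w0.2 * dot v0 w + v0.1 * dot v1 w).
    case: w => c d; congr (_, _).
      by rewrite -[LHS]mulr1 -w0v0 /dot /v1 /=; ring.
    by rewrite -[LHS]mulr1 -w0v0 /dot /v1 /=; ring.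
  by rewrite [LHS]coord [RHS]coord e d1 d2.
- move=> C D; rewrite mem_enum => sC; have CA : C \in A by case/setD1P: sC.
  have [mD dD] := nrepP _ (memT D).
  rewrite /prod_system /x /a.
  (* Each factor becomes a Frobenius power of [z - root], and the exponents [q ^ j] add up to
     [#|H|]. *)
  under eq_bigr do rewrite -exprBn_pchar //.
  rewrite -expr_sum -cH -exprVn -[RHS]mul1r.
  rewrite -(normAB _ _ _ _ CA (repP _ CA) (memT D) mD) (dot_decomp (rep C)) // -exprMn.
  congr (_ ^+ _); rewrite /root_of; field; exact: al0.
Qed.

Local Close Scope ring_scope.

Theorem theorem7 (q r : nat) (F : finFieldType) (H : {group {unit F}}) :
  (exists p k : nat, [/\ prime p, (0 < k)%N & q = p ^ k]) ->
  (2 <= r)%N ->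
  #|F| = (q ^ (r - 1))%N ->
  #|H| = (\sum_(i < r - 1) q ^ i)%N ->
  Kfree (vset H) (@adjG F H) r ((r - 1)`! + 1).
Proof.
move=> [p [k [pp _ qE]]]; case: r => [//|t] t0; rewrite subn1 addn1 => cF cH.
by apply: norm_graph_Kfree cF cH => //; exists p, k.
Qed.
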